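(* Suppose $V(B,\mathbf b)\ne\emptyset$ and $H_1^{(B,\mathbf b)},\ldots,H_m^{(B,\mathbf b)}$ are codimension-one (affine) subspaces of $V(B,\mathbf b)$. For any integers $q>q_0$ and $1\le a\le\rho_C$, if $\gcd(q,\rho_C)=\gcd(a,\rho_C)$ and $[\mathbf c_J]_q\in\mathrm{Col}_q(C_J)$ for all $J\subseteq[m]$ with $\bar r(J)=r(J)$, then $$0<w_j\big(\mathcal{A}^{(B,\mathbf b)}\big)=\gamma_j(1)\le\gamma_j(a)=\beta_j(q)\quad\text{for all } r\le j\le s.$$ Moreover, when $\mathbf a=\mathbf 0$ and $\mathbf b=\mathbf 0$, for any integers $q\ge1$ and $1\le a\le\rho_C$, if $\gcd(q,\rho_C)=\gcd(a,\rho_C)$, then $$0<w_j\big(\mathcal{A}^{(B,\mathbf 0)}\big)=\gamma_j(1)\le\gamma_j(a)=\beta_j(q)\quad\text{for all } r\le j\le s.$$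
   Context: Let $A$ be an $m\times n$ integer matrix with rows $\boldsymbol\alpha_1^T,\dots,\boldsymbol\alpha_m^T$, $B$ an $l\times n$ integer matrix ($l=0$ is allowed: no equations), $\mathbf a=(a_1,\dots,a_m)^T\in\mathbb{Z}^m$, $\mathbf b\in\mathbb{Z}^l$, and $[m]=\{1,\dots,m\}$. (Italic $a$ is an integer, bold $\mathbf a,\mathbf b$ are vectors.) For a positive integer $q$, $\mathbb{Z}_q=\mathbb{Z}/q\mathbb{Z}$, $[\cdot]_q$ is the entrywise reduction modulo $q$, and $\mathrm{Col}_q(N)$ is the $\mathbb{Z}_q$-module generated by the columns of $[N]_q$. Let $V(B,\mathbf b)=\{\mathbf x\in\mathbb{R}^n: B\mathbf x=\mathbf b\}$ and $H_i^{(B,\mathbf b)}=\{\mathbf x\in V(B,\mathbf b):\boldsymbol\alpha_i^T\mathbf x=a_i\}$; the truncated arrangement is $\mathcal{A}^{(B,\mathbf b)}=\{H_1^{(B,\mathbf b)},\dots,H_m^{(B,\mathbf b)}\}$, with characteristic polynomial $$\chi\big(\mathcal{A}^{(B,\mathbf b)},t\big)=\sum_{J\subseteq[m],\ \bigcap_{j\in J}H_j^{(B,\mathbf b)}\ne\emptyset}(-1)^{\#J}t^{\dim(\bigcap_{j\in J}H_j^{(B,\mathbf b)})}$$ (the intersection for $J=\emptyset$ being $V(B,\mathbf b)$). Let $r=\operatorname{rank}(B)$ and $s=\operatorname{rank}\begin{bmatrix}B\\ A\end{bmatrix}$. The numbers $w_j\big(\mathcal{A}^{(B,\mathbf b)}\big)$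 are defined by $\chi\big(\mathcal{A}^{(B,\mathbf b)},t\big)=\sum_{j=r}^s(-1)^{j-r}w_j\big(\mathcal{A}^{(B,\mathbf b)}\big)t^{n-j}$. For $J\subseteq[m]$, let $A_J$ and $\mathbf a_J$ consist of the rows of $A$ and entries of $\mathbf a$ indexed by $J$; $C_J=\begin{bmatrix}B\\ A_J\end{bmatrix}$, $\mathbf c_J=\begin{bmatrix}\mathbf b\\ \mathbf a_J\end{bmatrix}$, $\bar C_J=[C_J\ \mathbf c_J]$; $r(J)=\operatorname{rank}C_J$, $\bar r(J)=\operatorname{rank}\bar C_J$ (ranks over $\mathbb{Q}$). The invariant factors of an integer matrix are the nonzero diagonal entries (taken positive, each dividing the next) of its Smith normal form; let $d_{J,1}\mid\cdots\mid d_{J,r(J)}$ be those of $C_J$ and $\bar d_{J,1}\mid\cdots\mid\bar d_{J,\bar r(J)}$ those of $\bar C_J$. Put $\rho_C=\operatorname{lcm}\{d_{J,r(J)}: J\subseteq[m],\ \bar r(J)=r(J)\}$ and $q_0=\max\{\bar d_{J,\bar r(J)}: J\subseteq[m],\ \bar r(J)=r(J)+1\}$, with $q_0=0$ if no such $J$ exists; $d_{J,0}=1$. For $J$ with $\bar r(J)=r(J)$ and a positive integer $q$, let $\tilde d_J(q)=\prod_{j=1}^{r(J)}\gcd(d_{J,j},q)$ if $\gcd(q,d_{J,j})=\gcd(q,\bar d_{J,j})$ for all $j=1,\dots,r(J)$, and $\tilde d_J(q)=0$ otherwise. For $r\le j\le s$ and a positive integer $q$ set $$\beta_j(q)=(-1)^{j-r}\sum_{J\subseteq[m],\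 \bar r(J)=r(J)=j}(-1)^{\#J}\tilde d_J(q),$$ and for $1\le a\le\rho_C$ let $\gamma_j(a)$ be given by the same formula with $q$ replaced by $a$. These are the unsigned coefficients of the characteristic quasi-polynomial $\chi^{\mathrm{quasi}}\big(\mathcal{A}^{(B,\mathbf b)},q\big)=\sum_{j=r}^s(-1)^{j-r}\beta_j(q)q^{n-j}$ and of its $a$-constituent $f_a\big(\mathcal{A}^{(B,\mathbf b)},t\big)=\sum_{j=r}^s(-1)^{j-r}\gamma_j(a)t^{n-j}$. *)

(* Defs.v *)
From mathcomp Require Import all_boot all_order all_algebra.
From mathcomp Require Import boolp classical_sets reals.

Set Implicit Arguments.
Unset Strict Implicit.
Unset Printing Implicit Defensive.

Import Order.TTheory GRing.Theory Num.Theory.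
Local Open Scope classical_set_scope.
Local Open Scope ring_scope.

Definition rankQ p k (M : 'M[int]_(p, k)) : nat :=
  \rank (map_mx intr M : 'M[rat]_(p, k)).

(* [d] lists the nonzero diagonal entries of the Smith normal form of [M];
   [nth 0 d i] supplies the remaining zeros of the diagonal. *)
Definition is_invariant_factors p k (M : 'M[int]_(p, k)) (d : seq nat) : Prop :=
  [/\ all (fun x => 0 < x)%N d, sorted dvdn d, (size d <= minn p k)%N
    & exists L : 'M[int]_p, exists R : 'M[int]_k,
      [/\ L \in unitmx, R \in unitmx
        & M = L *m (\matrix_(i < p, j < k)
                     ((nth 0%N d i)%:Z *+ (i == j :> nat))) *m R] ].

Definition invariant_factors p k (M : 'M[int]_(p, k)) : seq nat :=
  xget [::] [set d | is_invariant_factors M d].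

(* The [j]-th invariant factor, numbered from 1; it is 1 for [j = 0], and
   [j > rankQ M] is never used. *)
Definition inv_factor p k (M : 'M[int]_(p, k)) (j : nat) : nat :=
  nth 1%N (1%N :: invariant_factors M) j.

(* [c] modulo [q] lies in the Z/qZ-module generated by the columns of [N]
   modulo [q]. Written with congruences because ['Z_1] is not the zero ring. *)
Definition in_Col p k (q : nat) (N : 'M[int]_(p, k)) (c : 'cV[int]_p) : Prop :=
  exists x : 'cV[int]_k, forall i, (c i ord0 = (N *m x)%R i ord0 %[mod q])%Z.

Section AffineSubspaces.
Variables (R : realType) (n : nat).

Definition is_affine_subspace (X : set 'cV[R]_n) (d : nat) : Prop :=
  exists x0 : 'cV[R]_n, exists U : {vspace 'cV[R]_n},
    \dim U = d /\ X = [set x | x - x0 \in U].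

Definition affine_dim (X : set 'cV[R]_n) : nat :=
  xget 0%N [set d | is_affine_subspace X d].

Definition codim_one (V H : set 'cV[R]_n) : Prop :=
  H `<=` V /\
  exists d : nat, is_affine_subspace V d.+1 /\ is_affine_subspace H d.

End AffineSubspaces.

Section TruncatedArrangement.
Variables (R : realType) (m n l : nat).
Variables (A : 'M[int]_(m, n)) (a : 'cV[int]_m).
Variables (B : 'M[int]_(l, n)) (b : 'cV[int]_l).

Definition ambient : set 'cV[R]_n :=
  [set x | map_mx intr B *m x = map_mx intr b].

Definition hyperplane (i : 'I_m) : set 'cV[R]_n :=
  [set x | ambient x /\ (map_mx intr (row i A) *m x) 0 0 = (a i 0)%:~R].

Definition flat (J : {set 'I_m}) : set 'cV[R]_n :=
  ambient `&` \bigcap_(j in [set j | j \in J]) hyperplane j.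

Definition char_poly_arr : {poly int} :=
  \sum_(J : {set 'I_m} | `[< flat J !=set0 >])
    (-1) ^+ #|J| *: 'X^(affine_dim (flat J)).

Definition w_coef (j : nat) : int :=
  (-1) ^+ (j - rankQ B) * char_poly_arr`_(n - j).

End TruncatedArrangement.

Arguments ambient R {n l} B b.
Arguments hyperplane R {m n l} A a B b i.
Arguments flat R {m n l} A a B b J.
Arguments char_poly_arr R {m n l} A a B b.
Arguments w_coef R {m n l} A a B b j.

Section QuasiPolynomial.
Variables (m n l : nat).
Variables (A : 'M[int]_(m, n)) (a : 'cV[int]_m).
Variables (B : 'M[int]_(l, n)) (b : 'cV[int]_l).
Implicit Type J : {set 'I_m}.

Definition CJ J : 'M[int]_(l + #|J|, n) :=
  col_mx B (rowsub (fun i : 'I_#|J| => enum_val i) A).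

Definition cJ J : 'cV[int]_(l + #|J|) :=
  col_mx b (rowsub (fun i : 'I_#|J| => enum_val i) a).

Definition CbarJ J : 'M[int]_(l + #|J|, n + 1) := row_mx (CJ J) (cJ J).

Definition rJ J : nat := rankQ (CJ J).
Definition rbarJ J : nat := rankQ (CbarJ J).

Definition dJ J (j : nat) : nat := inv_factor (CJ J) j.
Definition dbarJ J (j : nat) : nat := inv_factor (CbarJ J) j.

Definition rhoC : nat :=
  \big[lcmn/1%N]_(J : {set 'I_m} | rbarJ J == rJ J) dJ J (rJ J).

Definition q0 : nat :=
  (\max_(J : {set 'I_m} | rbarJ J == (rJ J).+1) dbarJ J (rbarJ J))%N.

Definition dtilde J (q : nat) : nat :=
  if [forall j : 'I_(rJ J), gcdn q (dJ J j.+1) == gcdn q (dbarJ J j.+1)]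
  then (\prod_(j < rJ J) gcdn (dJ J j.+1) q)%N
  else 0%N.

Definition beta (j q : nat) : int :=
  (-1) ^+ (j - rankQ B) *
  \sum_(J : {set 'I_m} | (rbarJ J == rJ J) && (rJ J == j))
    (-1) ^+ #|J| * (dtilde J q)%:Z.

(* Coefficient of the [k]-constituent, for [1 <= k <= rhoC]. *)
Definition gamma (j k : nat) : int :=
  (-1) ^+ (j - rankQ B) *
  \sum_(J : {set 'I_m} | (rbarJ J == rJ J) && (rJ J == j))
    (-1) ^+ #|J| * (dtilde J k)%:Z.

End QuasiPolynomial.

(* Main.v *)
(* Let S(z) be the set of hyperplanes through z in (Z/q)^n.  If the systems
   C_J x = c_J with J central are solvable modulo q, then dtilde_J(q) q^(n - r(J))
   counts the solutions modulo q, so that q^(n - j) beta_j(q) is the sum, over the z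
   with B z = b modulo q, of the coefficients w_j of the subarrangements S(z).
   By Whitney's broken circuit theorem, w_j counts the central sets of rank j without
   broken circuit (NBC sets), and an NBC set of the whole arrangement that is contained
   in S(z) is an NBC set of S(z).  Hence q^(n - j) beta_j(q) is at least the number of
   pairs (J, z) where J is such an NBC set and z a solution modulo q of C_J z = c_J,
   which is at least q^(n - j) w_j.  The equality gamma_j(a) = beta_j(q) holds because
   dbar_{J,i} divides d_{J,i}, hence rhoC, for J central. *)

Require Import Defs.
From mathcomp Require Import boolp classical_sets reals.
From mathcomp Require Import all_boot all_order all_algebra.
From mathcomp Require Import zify.

Set Implicit Arguments.
Unset Strict Implicit.
Unset Printing Implicit Defensive.

Import Order.TTheory GRing.Theory Num.Theory.
Local Open Scope ring_scope.

(** * Whitney's broken circuit theorem for vectors modulo a subspace *)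

Section NoBrokenCircuit.

Variables (K : fieldType) (N m p : nat).
Variables (U : 'M[K]_(p, N)) (v : 'I_m -> 'rV[K]_N).
Implicit Types (I J S T : {set 'I_m}) (i k : 'I_m).

(** Including [U] in every span contracts it: ranks in excess of [\rank U] are those of the matroid
    of the [v i] modulo [U]. *)
Definition rowspan J : 'M[K]_N := (U + \sum_(i in J) <<v i>>)%MS.

Lemma rowspan_subP J q (M : 'M[K]_(q, N)) :
  reflect ((U <= M)%MS /\ forall i, i \in J -> (v i <= M)%MS)
    (rowspan J <= M)%MS.
Proof.
rewrite /rowspan addsmx_sub; apply: (iffP andP) => -[UM vM]; split=> //.
  by move=> i iJ; move/sumsmx_subP: vM => /(_ i iJ); rewrite genmxE.
by apply/sumsmx_subP => i iJ; rewrite genmxE vM.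
Qed.

Lemma base_rowspan J : (U <= rowspan J)%MS.
Proof. exact: addsmxSl. Qed.

Lemma mem_rowspan J i : i \in J -> (v i <= rowspan J)%MS.
Proof. by move=> iJ; have /rowspan_subP[_ ->] := submx_refl (rowspan J). Qed.

Lemma rowspanS I J : I \subset J -> (rowspan I <= rowspan J)%MS.
Proof.
move=> /subsetP sIJ; apply/rowspan_subP; split; first exact: base_rowspan.
by move=> i /sIJ; apply: mem_rowspan.
Qed.

Lemma rowspan0 : (rowspan set0 :=: U)%MS.
Proof. by rewrite /rowspan big_set0; apply: addsmx0. Qed.

Lemma rowspanU1 J i : (rowspan (i |: J) :=: rowspan J + v i)%MS.
Proof.
apply/eqmxP/andP; split.
  apply/rowspan_subP; split; first exact: submx_trans (base_rowspan J) (addsmxSl _ _).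
  move=> k; rewrite in_setU1 => /orP[/eqP->|kJ]; first exact: addsmxSr.
  exact: submx_trans (mem_rowspan kJ) (addsmxSl _ _).
by rewrite addsmx_sub rowspanS ?subsetUr // mem_rowspan ?setU11.
Qed.

Lemma rank_add_row q (M : 'M[K]_(q, N)) (w : 'rV[K]_N) :
  \rank (M + w)%MS = (\rank M + ~~ (w <= M)%MS)%N.
Proof.
have [wM|wM] := boolP (w <= M)%MS.
  by rewrite addn0 (addsmx_idPl wM).
have w0 : w != 0 by apply: contraNneq wM => ->; apply: sub0mx.
rewrite mxrank_disjoint_sum ?rank_rV ?w0 //.
apply/eqP/rowV0P => u; rewrite sub_capmx => /andP[uM].
move=> /sub_rVP[c uE]; have [c0|c0] := eqVneq c 0; first by rewrite uE c0 scale0r.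
by move: wM; rewrite uE in uM; rewrite -(eqmx_scale _ c0) uM.
Qed.

Lemma rank_rowspanU1 J i :
  \rank (rowspan (i |: J)) = (\rank (rowspan J) + ~~ (v i <= rowspan J)%MS)%N.
Proof. by rewrite rowspanU1 rank_add_row. Qed.

Lemma rowspanU1_id J i : (v i <= rowspan J)%MS -> (rowspan (i |: J) :=: rowspan J)%MS.
Proof. by move=> viJ; apply: eqmx_trans (rowspanU1 J i) (addsmx_idPl viJ). Qed.

(** Steinitz exchange: [M + w] lies in [M + u] and both have rank one more than [M], so they
    coincide. *)
Lemma add_row_exchange q (M : 'M[K]_(q, N)) (u w : 'rV[K]_N) :
  (w <= M + u)%MS -> ~~ (w <= M)%MS -> (u <= M + w)%MS.
Proof.
move=> wMu wM; have uM : ~~ (u <= M)%MS.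
  by apply: contraNN wM => /addsmx_idPl <-.
have sub : (M + w <= M + u)%MS by rewrite addsmx_sub addsmxSl.
have := mxrank_leqif_sup sub; rewrite !rank_add_row uM wM => -[_].
by rewrite eqxx => /esym; apply: submx_trans; apply: addsmxSr.
Qed.

Definition above i J : {set 'I_m} := [set k in J | i < k]%N.

(* In the matroid of the [v i] modulo [U], a broken circuit is a circuit minus its
   least element, and it spans that element from above: this states that [J] contains
   no broken circuit, independence of [J] being a consequence ([rank_nbc]). *)
Definition nbc T J : bool :=
  (J \subset T) && [forall i in T, ~~ (v i <= rowspan (above i J))%MS].

Lemma above_subset i J : above i J \subset J.
Proof. by apply/subsetP => k; rewrite inE => /andP[]. Qed.

Lemma aboveS i I J : I \subset J -> above i I \subset above i J.
Proof. by move=> /subsetP sIJ; apply/subsetP => k; rewrite !inE => /andP[/sIJ-> ->]. Qed.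

Lemma nbc_subset T I J : I \subset J -> nbc T J -> nbc T I.
Proof.
move=> sIJ /andP[sJT /forall_inP nbJ]; rewrite /nbc (subset_trans sIJ) //=.
apply/forall_inP => i iT; apply: contraNN (nbJ i iT) => viI.
exact: submx_trans viI (rowspanS (aboveS i sIJ)).
Qed.

(** A smaller ground set offers fewer elements to complete a circuit. This is the source of the
    inequality between coefficients. *)
Lemma nbc_restrict S T J : S \subset T -> J \subset S -> nbc T J -> nbc S J.
Proof.
move=> /subsetP sST sJS /andP[sJT /forall_inP nbJ]; rewrite /nbc sJS.
by apply/forall_inP => i /sST; apply: nbJ.
Qed.

(** Induction on the cardinality: the other elements of [J] all lie above its least one, so by the
    NBC condition removing the latter lowers the rank by one. *)
Lemma rank_nbc T J : nbc T J -> \rank (rowspan J) = (\rank U + #|J|)%N.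
Proof.
move: {2}#|J| (erefl #|J|) => c; elim: c => [|c IH] in J *.
  by move=> /eqP; rewrite cards_eq0 => /eqP-> _; rewrite rowspan0 cards0 addn0.
move=> cJ nbJ; have /card_gt0P[i0 i0J] : (0 < #|J|)%N by rewrite cJ.
case: (@arg_minnP _ i0 (fun i => i \in J) val i0J) => i iJ imin.
have aJ : above i J = J :\ i.
  apply/setP => k; rewrite !inE andbC; apply: andb_id2r => kJ.
  by have := imin k kJ; rewrite ltn_neqAle => ->; rewrite andbT eq_sym.
have iD : #|J :\ i| = c by move: cJ; rewrite (cardsD1 i) iJ => -[].
rewrite -{1}(setD1K iJ) rank_rowspanU1 IH ?(nbc_subset (subsetDl J [set i])) //.
have /andP[sJT /forall_inP/(_ i)] := nbJ; rewrite aJ => ->; last exact: (subsetP sJT).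
by rewrite iD cJ -addnA addn1.
Qed.

Definition toggle i J := if i \in J then J :\ i else i |: J.

Lemma toggleK i : involutive (toggle i).
Proof.
move=> J; rewrite {2}/toggle; have [iJ|iJ] := boolP (i \in J).
  by rewrite /toggle setD11 setD1K.
by rewrite /toggle setU11 setU1K.
Qed.

Lemma sign_toggle i J : (-1) ^+ #|toggle i J| = - (-1) ^+ #|J| :> int.
Proof.
rewrite /toggle; have [iJ|iJ] := boolP (i \in J).
  by rewrite (cardsD1 i J) iJ exprS mulN1r opprK.
by rewrite cardsU1 iJ exprS mulN1r.
Qed.

Lemma above_toggle k i J : (i <= k)%N -> above k (toggle i J) = above k J.
Proof.
move=> ik; apply/setP => h; rewrite !inE /toggle.
have [hk|] := ltnP k h; last by rewrite !andbF.
have hi : (h == i) = false by apply: gtn_eqF; apply: leq_ltn_trans hk.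
by case: ifP => _; rewrite !inE hi.
Qed.

Lemma toggle_invariant (P : pred {set 'I_m}) i :
  (forall J, P (i |: J) = P J) -> forall J, P (toggle i J) = P J.
Proof.
move=> Pi J; rewrite /toggle; have [iJ|iJ] := boolP (i \in J); last exact: Pi.
by rewrite -Pi setD1K.
Qed.

Lemma toggle_sum0 (P : pred {set 'I_m}) i :
  (forall J, P (toggle i J) = P J) -> \sum_(J : {set _} | P J) (-1) ^+ #|J| = 0 :> int.
Proof.
move=> Pi; set s := \sum_(J : {set _} | _) _.
suff: s = - s by lia.
rewrite {1}/s (reindex_inj (can_inj (toggleK i))) /= -sumrN.
by apply: eq_big => [J|J _]; rewrite ?Pi ?sign_toggle.
Qed.

Variable P : pred {set 'I_m}.
(** [P] is to depend on the span only; it will say that [J] is central of rank [j]. *)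
Hypothesis P_closure : forall J i, (v i <= rowspan J)%MS -> P (i |: J) = P J.

Lemma closure_toggle i J :
  (v i <= rowspan (above i J))%MS -> P (toggle i J) = P J.
Proof.
move=> viJ; rewrite /toggle; have [iJ|iJ] := boolP (i \in J).
  rewrite -[in RHS](setD1K iJ) P_closure //; apply: submx_trans viJ _.
  apply/rowspanS/subsetP => k; rewrite !inE => /andP[-> ik].
  by rewrite andbT -val_eqE /= gtn_eqF.
by apply/P_closure/(submx_trans viJ)/rowspanS/above_subset.
Qed.

(* Whitney's broken circuit theorem: toggling the largest [i] such that
   [v i] is spanned by the elements of [J] above [i] is a sign-reversing
   involution on the other sets. *)
Lemma sum_nbc T :
  \sum_(J : {set _} | (J \subset T) && P J) (-1) ^+ #|J|
  = \sum_(J : {set _} | nbc T J && P J) (-1) ^+ #|J| :> int.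
Proof.
pose bad J i := (v i <= rowspan (above i J))%MS.
(* Only the bad indices from [t] on are forbidden. Lowering [t] from [m] to 0 passes from all
   subsets of [T] to the NBC sets, one index at a time. *)
pose good t J := [&& J \subset T, P J & [forall i in T, (t <= i)%N ==> ~~ bad J i]].
suff good_sum t : (t <= m)%N ->
    \sum_(J : {set _} | (J \subset T) && P J) (-1) ^+ #|J|
    = \sum_(J | good (m - t)%N J) (-1) ^+ #|J| :> int.
  rewrite (good_sum m) // subnn; apply: eq_bigl => J.
  rewrite /good /nbc -andbA; congr andb; rewrite andbC; congr andb.
elim: t => [_|t IH tm].
  apply: eq_bigl => J; rewrite /good; case: (J \subset T) => //=.
  rewrite subn0; have -> : [forall i in T, (m <= i)%N ==> ~~ bad J i].
    by apply/forall_inP => i _; rewrite leqNgt ltn_ord.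
  by rewrite andbT.
rewrite IH ?(ltnW tm) //; have ht : (m - t.+1 < m)%N by lia.
pose i := Ordinal ht; have -> : (m - t = i.+1)%N by rewrite /=; lia.
change (m - t.+1)%N with (i : nat).
have [iT|iT] := boolP (i \in T); last first.
  apply: eq_bigl => J; rewrite /good; congr (_ && (_ && _)).
  apply: eq_forallb => k; apply: implyb_id2l => kT.
  rewrite [in RHS]leq_eqVlt; case: eqP => //= ik.
  by case/negP: iT; rewrite (val_inj (ik : val i = val k)).
(* The sets for which [i] is bad cancel in pairs under [toggle i]: this changes no [above k] with
   [i <= k], and it preserves [P] because [v i] is spanned by the elements above [i]. *)
rewrite (bigID (bad ^~ i)) /= [X in X + _](@toggle_sum0 _ i) ?add0r.
  apply: eq_bigl => J; rewrite /good -!andbA; congr (_ && (_ && _)).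
  apply/andP/idP => [[/forall_inP h nb]|/forall_inP h].
    apply/forall_inP => k kT; rewrite leq_eqVlt; apply/implyP => /orP[/eqP ik|ik];
      last exact: (implyP (h k kT)).
    by rewrite -(val_inj (ik : val i = val k)).
  split; last by have := h i iT; rewrite leqnn.
  by apply/forall_inP => k kT; apply/implyP => ik; apply: (implyP (h k kT)); apply: ltnW.
move=> J; have [badJ|] := boolP (bad J i); last first.
  by rewrite andbF /bad above_toggle // => /negPf->; rewrite andbF.
rewrite /good (closure_toggle badJ) -!andbA; congr andb.
  by apply: (toggle_invariant (P := fun J => J \subset T)) => J'; rewrite subUset sub1set iT.
congr (_ && (_ && _)); last by rewrite /bad above_toggle.
apply: eq_forallb => k; apply: implyb_id2l => _; apply: implyb_id2l => ik.
by rewrite /bad above_toggle // ltnW.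
Qed.

End NoBrokenCircuit.

(** * NBC sets of every admissible rank whose span avoids a given vector *)

Section NoBrokenCircuitExistence.

Variables (K : fieldType) (N m p : nat).
Variables (U : 'M[K]_(p, N)) (v : 'I_m -> 'rV[K]_N) (e : 'rV[K]_N).
Hypothesis no_loop : forall i, ~~ (v i <= U)%MS.
Hypothesis e_notin : ~~ (e <= U)%MS.
Implicit Types (I J : {set 'I_m}) (i k : 'I_m).

Let span J := rowspan U v J.

(** Take [J] of maximal cardinality with [e] outside its span. Adding any other [i] brings [e] into
    the span, so by exchange [v i] lies in [span J + e], which therefore contains everything. *)
Lemma maximal_avoiding : exists J,
  [/\ ~~ (e <= span J)%MS, (forall i, (v i <= span J)%MS -> i \in J)
    & (\rank (span [set: 'I_m] + e)%MS <= (\rank (span J)).+1)%N].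
Proof.
have c0 : ~~ (e <= span set0)%MS by rewrite /span rowspan0.
case: (@arg_maxnP _ set0 (fun J => ~~ (e <= span J)%MS) (fun J => #|J|) c0) => J eJ Jmax.
have maxJ i : i \notin J -> (e <= span (i |: J))%MS.
  move=> iJ; apply: contraTT isT => /Jmax.
  by rewrite cardsU1 iJ add1n /= ltnn.
have closedJ i : (v i <= span J)%MS -> i \in J.
  move=> viJ; apply: contraNT eJ => /maxJ.
  by rewrite /span (rowspanU1_id viJ).
exists J; split=> //; have <- : \rank (span J + e)%MS = (\rank (span J)).+1.
  by rewrite rank_add_row eJ addn1.
apply: mxrankS; rewrite addsmx_sub addsmxSr andbT.
apply/rowspan_subP; split; first exact: submx_trans (base_rowspan _ _ _) (addsmxSl _ _).
move=> i _; have [iJ|/maxJ] := boolP (i \in J).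
  exact: submx_trans (mem_rowspan _ _ iJ) (addsmxSl _ _).
by rewrite rowspanU1 => /add_row_exchange; apply.
Qed.

(* The lexicographically first basis of [J] contains no broken circuit. *)
Lemma nbc_basis J : (forall i, (v i <= span J)%MS -> i \in J) ->
  exists G : {set _}, [/\ G \subset J, nbc U v setT G & (span J <= span G)%MS].
Proof.
move=> closedJ; pose below i := [set k in J | k < i]%N.
pose G := [set i in J | ~~ (v i <= span (below i))%MS].
have sGJ : G \subset J by apply/subsetP => i; rewrite inE => /andP[].
exists G; split=> //; last first.
  suff h t i : (i < t)%N -> i \in J -> (v i <= span G)%MS.
    apply/rowspan_subP; split; first exact: base_rowspan.
    by move=> i; apply: (h m).
  elim: t i => // t IH i it iJ.
  have [iG|] := boolP (i \in G); first exact: mem_rowspan.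
  rewrite inE iJ negbK => /submx_trans; apply; apply/rowspan_subP; split.
    exact: base_rowspan.
  by move=> k; rewrite inE => /andP[kJ ki]; apply: IH => //; apply: leq_trans ki _.
rewrite /nbc subsetT; apply/forall_inP => i _; apply/negP => viG.
(* Closedness of [J] makes [i] a candidate in the greedy choice of [G]. *)
have iJ : i \in J.
  by apply/closedJ/(submx_trans viG)/rowspanS/(subset_trans (above_subset i G)).
(* The least [t] singles out the largest element [k] of [G] needed to span [v i]. By exchange, [v k]
   is spanned by [v i] and smaller elements of [G], all below [k] in [J], against the choice of
   [G]. *)
pose upto t := [set k in above i G | (k < t)%N].
have /ex_minnP[t vit tmin] : exists t, (v i <= span (upto t))%MS.
  exists m; apply: submx_trans viG _; apply/rowspanS/subsetP => k kG.
  by rewrite inE kG ltn_ord.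
case: t => [|t] in vit tmin.
  have := no_loop i; rewrite -(rowspan0 U v).
  suff <- : upto 0%N = set0 by rewrite -/(span _) vit.
  by apply/setP => k; rewrite !inE andbF.
have vit' : ~~ (v i <= span (upto t))%MS by apply/negP => /tmin; rewrite ltnn.
have /exists_inP[k kt /eqP tE] : [exists k in above i G, k == t :> nat].
  apply: contraNT vit' => /exists_inPn nok.
  apply: submx_trans vit _; apply/rowspanS/subsetP => k; rewrite !inE ltnS => /andP[kG].
  rewrite leq_eqVlt kG => /orP[kt|//].
  by have := nok k; rewrite !inE kG kt => /(_ isT).
have kG : k \in G by apply: subsetP kt; apply: above_subset.
have ik : (i < k)%N by move: kt; rewrite inE => /andP[].
have uptoS : upto t.+1 = k |: upto t.
  rewrite /upto; move: (above i G) kt => S kS.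
  apply/setP => h; rewrite !inE ltnS leq_eqVlt -tE -val_eqE /=.
  by have [/val_inj->|_] := eqVneq (val h) (val k); rewrite ?kS.
move: kG; rewrite inE => /andP[kJ /negP]; apply.
rewrite uptoS /span rowspanU1 in vit.
apply: submx_trans (add_row_exchange vit vit') _.
rewrite -rowspanU1; apply/rowspanS/subsetP => h; rewrite in_setU1 => /orP[/eqP->|].
  by rewrite inE iJ.
by rewrite !inE -tE => /andP[/andP[/andP[-> _] _] ->].
Qed.

(** An NBC basis [G] of a maximal set avoiding [e] has rank at least [j]. Subsets of [G] are again
    NBC, hence independent modulo [U], so any [j - \rank U] elements of [G] will do. *)
Lemma nbc_exists j : (\rank U <= j < \rank (span [set: 'I_m] + e)%MS)%N ->
  exists J : {set _}, [/\ nbc U v setT J, ~~ (e <= span J)%MS & \rank (span J) = j].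
Proof.
move=> /andP[Uj js]; have [J [eJ closedJ rJ]] := maximal_avoiding.
have [G [sGJ nG sJG]] := nbc_basis closedJ.
pose H := [set i in take (j - \rank U) (enum G)].
have sHG : H \subset G.
  by apply/subsetP => i; rewrite inE => /mem_take; rewrite mem_enum.
have nH := nbc_subset sHG nG; exists H; split=> //.
  by apply: contraNN eJ => /submx_trans; apply; apply/rowspanS/(subset_trans sHG).
rewrite (rank_nbc nH) cardsE (card_uniqP _) ?take_uniq ?enum_uniq // size_take -cardE.
have := leq_trans js rJ; rewrite ltnS => /leq_trans /(_ (mxrankS sJG)).
by rewrite (rank_nbc nG); case: ifP; lia.
Qed.

End NoBrokenCircuitExistence.

(** * Invariant factors of integer matrices, and the effect of adding a column *)

Section InvariantFactors.

Definition snf_mx p k (d : seq nat) : 'M[int]_(p, k) :=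
  \matrix_(i < p, j < k) ((nth 0%N d i)%:Z *+ (i == j :> nat)).

(** The diagonal of a Smith form is cut to length [minn p k], made nonnegative, and cut at its first
    zero, after which divisibility leaves only zeros. The signs go into the left factor through the
    involution [S]. *)
Lemma invariant_factors_exist p k (M : 'M[int]_(p, k)) :
  exists d, is_invariant_factors M d.
Proof.
have [L uL [R uR [d sd ->]]] := int_Smith_normal_form M.
pose s := [seq `|x|%N | x <- take (minn p k) d]; pose t := find (pred1 0%N) s.
have ss : sorted dvdn s.
  by rewrite sorted_map; apply: sub_sorted (take_sorted _ sd) => x y; exact: id.
have sE i : nth 0%N (take t s) i = nth 0%N s i.
  have [ti|it] := ltnP i t; first exact: nth_take.
  rewrite nth_default ?size_take; last by apply: leq_trans it; case: ltnP.
  have [si|si] := leqP (size s) i; first by rewrite nth_default.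
  have hs : has (pred1 0%N) s by rewrite has_find; apply: leq_ltn_trans si.
  have /eqP t0 := nth_find 0%N hs.
  have : (nth 0 s t %| nth 0 s i)%N.
    by apply: (sorted_leq_nth dvdn_trans dvdnn) => //; rewrite inE -?has_find.
  by rewrite t0 dvd0n => /eqP.
exists (take t s); split.
- apply/(all_nthP 0%N) => i; rewrite size_take => it.
  have {}it : (i < t)%N by case: (ltnP t (size s)) it => // st /leq_trans; apply.
  by rewrite nth_take // lt0n; have := before_find 0%N it => /= ->.
- exact: take_sorted.
- rewrite size_take; apply: leq_trans (_ : size s <= _)%N; first by case: ltnP => // /ltnW.
  by rewrite size_map size_take; case: ltnP.
pose e (i : 'I_p) : int := (-1) ^+ (d`_i < 0)%R.
pose S : 'M[int]_p := diag_mx (\row_i e i).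
have SS : S *m S = 1%:M.
  rewrite mulmx_diag -diag_const_mx; congr diag_mx; apply/rowP => i.
  by rewrite !mxE -expr2 sqrr_sign.
exists (L *m S), R; split=> //; first by rewrite unitmx_mul uL; case/mulmx1_unit: SS.
congr (_ *m _); rewrite -mulmxA; congr (_ *m _); apply/matrixP => i j.
rewrite mul_diag_mx !mxE;
have [ij|_] := eqVneq (val i) (val j); last by rewrite !mulr0n mulr0.
rewrite !mulr1n sE {1}[d`_i]intEsign; congr (_ * _).
have im : (i < minn p k)%N by rewrite leq_min ltn_ord ij ltn_ord.
have [id|di] := ltnP i (size d).
  have ist : (i < size (take (minn p k) d))%N by rewrite size_take; case: (ltnP (minn p k)).
  by rewrite /s (nth_map 0) ?nth_take.
rewrite /s !nth_default // size_map size_take.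
by case: (ltnP (minn p k)) => // /ltnW/leq_trans; apply.
Qed.

Lemma invariant_factorsP p k (M : 'M[int]_(p, k)) :
  is_invariant_factors M (invariant_factors M).
Proof. by have [d dP] := invariant_factors_exist M; apply: (xgetPex _ (ex_intro _ d dP)). Qed.

Lemma invariant_factors_gt0 p k (M : 'M[int]_(p, k)) j :
  (j < size (invariant_factors M))%N -> (0 < nth 0 (invariant_factors M) j)%N.
Proof. by move=> js; have [/(all_nthP 0%N)/(_ j js)] := invariant_factorsP M. Qed.

(** The default 0 past the end is a multiple of everything, so the divisibility holds for all
    [i <= j]. *)
Lemma invariant_factors_dvd p k (M : 'M[int]_(p, k)) i j : (i <= j)%N ->
  (nth 0 (invariant_factors M) i %| nth 0 (invariant_factors M) j)%N.
Proof.
move=> ij; have [_ sd _ _] := invariant_factorsP M.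
have [js|sj] := ltnP j (size (invariant_factors M)); last by rewrite [X in (_ %| X)%N]nth_default.
by apply: (sorted_leq_nth dvdn_trans dvdnn) => //; rewrite inE (leq_ltn_trans ij).
Qed.

Lemma invariant_factors_snf p k (M : 'M[int]_(p, k)) :
  exists L : 'M[int]_p, exists R : 'M[int]_k, [/\ L \in unitmx, R \in unitmx
    & M = L *m snf_mx p k (invariant_factors M) *m R].
Proof. by have [_ _ _ [L [R [uL uR ME]]]] := invariant_factorsP M; exists L, R. Qed.

Lemma unitmx_intr (F : comUnitRingType) k (M : 'M[int]_k) :
  M \in unitmx -> (map_mx intr M : 'M[F]_k) \in unitmx.
Proof.
by rewrite !unitmxE det_map_mx; apply: (rmorph_unit (intr : {rmorphism int -> F})).
Qed.

Lemma size_invariant_factors p k (M : 'M[int]_(p, k)) :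
  size (invariant_factors M) = rankQ M.
Proof.
set d := invariant_factors M; have [_ _ sd _] := invariant_factorsP M.
have [L [R [uL uR ->]]] := invariant_factors_snf M; rewrite -/d.
rewrite /rankQ !map_mxM /= mxrankMfree ?row_free_unit ?unitmx_intr //.
rewrite eqmxMfull ?row_full_unit ?unitmx_intr //.
(* The zeros of the diagonal are replaced by 1, so that the Smith form is an invertible diagonal
   matrix times [pid_mx]. *)
pose e (i : 'I_p) : rat := if (i < size d)%N then (nth 0%N d i)%:R else 1.
have -> : map_mx intr (snf_mx p k d) = diag_mx (\row_i e i) *m pid_mx (size d).
  apply/matrixP => i j; rewrite mul_diag_mx !mxE /e.
  have [ij|_] := eqVneq (val i) (val j); last by rewrite !mulr0n mulr0.
  by case: ltnP => h; rewrite ?mulr1n ?mulr1 ?mulr0 //= nth_default.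
move: sd; rewrite leq_min => /andP[dp dk].
rewrite eqmxMfull ?rank_pid_mx // row_full_unit unitmxE det_diag unitfE.
apply/prodf_neq0 => i _; rewrite mxE /e; case: ifP => [id|_]; last exact: oner_neq0.
by rewrite pnatr_eq0 -lt0n invariant_factors_gt0.
Qed.

Lemma inv_factorS p k (M : 'M[int]_(p, k)) j : (j < rankQ M)%N ->
  inv_factor M j.+1 = nth 0%N (invariant_factors M) j.
Proof. by rewrite -size_invariant_factors => jM; apply: set_nth_default. Qed.

Lemma inv_factor_dvd p k (M : 'M[int]_(p, k)) i j : (i <= j <= rankQ M)%N ->
  (inv_factor M i %| inv_factor M j)%N.
Proof.
case: i => [|i]; first by rewrite {1}/inv_factor dvd1n.
case: j => // j /andP[ij jM]; rewrite !inv_factorS ?invariant_factors_dvd //.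
exact: leq_trans jM.
Qed.

(* The [j]-th invariant factor (from 0) is the largest modulus for which [M] has
   rank at most [j]: for the converse, a unimodular row annihilating the
   [(j + 1) x j] part of the left factor gives [c] divides [d_j]. *)
Lemma dvd_inv_factorP p k (M : 'M[int]_(p, k)) j c : (j < rankQ M)%N ->
  (c %| inv_factor M j.+1)%N <->
  exists X : 'M[int]_(p, j), exists Y : 'M[int]_(j, k), exists Z : 'M[int]_(p, k),
    M = X *m Y + c%:Z *: Z.
Proof.
move=> jM; rewrite inv_factorS //; set d := invariant_factors M.
have [L [R [uL uR ME]]] := invariant_factors_snf M; rewrite -/d in ME.
split=> [cd|[X [Y [Z MXY]]]].
  (* [X *m Y] carries the first [j] diagonal entries; the later ones are multiples of [c]. *)
  pose X : 'M[int]_(p, j) := \matrix_(i, h) ((nth 0%N d i)%:Z *+ (i == h :> nat)).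
  pose Y : 'M[int]_(j, k) := \matrix_(h, i) (h == i :> nat)%:R.
  pose Z : 'M[int]_(p, k) :=
    \matrix_(i, h) ((nth 0 d i %/ c)%N%:Z *+ ((i == h :> nat) && (j <= i)%N)).
  exists (L *m X), (Y *m R), (L *m Z *m R).
  have -> : L *m X *m (Y *m R) + c%:Z *: (L *m Z *m R) = L *m (X *m Y + c%:Z *: Z) *m R.
    by rewrite mulmxDr mulmxDl -scalemxAr -scalemxAl !mulmxA.
  rewrite ME; congr (_ *m _ *m _); apply/matrixP => i h; rewrite !mxE.
  have [ji|ij] := leqP j i.
    rewrite big1 ?add0r => [|g _]; last by rewrite !mxE gtn_eqF ?mul0r //; apply: leq_trans ji.
    rewrite andbT; case: eqP => [_|_]; last by rewrite !mulr0n mulr0.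
    rewrite !mulr1n -PoszM mulnC divnK //.
    by apply: dvdn_trans cd _; apply: invariant_factors_dvd.
  rewrite andbF mulr0n mulr0 addr0 (bigD1 (Ordinal ij)) //= !mxE eqxx mulr1n.
  rewrite big1 ?addr0 => [|g]; first by rewrite mulr_natr.
  by rewrite -val_eqE /= eq_sym !mxE => /negPf->; rewrite mul0r.
have [_ _ dpk _] := invariant_factorsP M.
have : (j < minn p k)%N by apply: leq_trans dpk; rewrite size_invariant_factors.
rewrite leq_min => /andP[jp jk].
pose top q (N : 'M[int]_(p, q)) : 'M[int]_(j.+1, q) := rowsub (widen_ord jp) N.
(* The Smith form of a matrix with [j + 1] rows and [j] columns has last row zero, so the last row
   [u] of the inverse of its left factor annihilates the matrix. *)
have [L2 [R2 [uL2 uR2 XE]]] := invariant_factors_snf (top _ (invmx L *m X)).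
pose u := row ord_max (invmx L2).
have uX : u *m top _ (invmx L *m X) = 0.
  rewrite /u XE -row_mul -mulmxA mulKmx // row_mul.
  have -> : row ord_max (snf_mx j.+1 j (invariant_factors (top _ (invmx L *m X)))) = 0.
    by apply/rowP => h; rewrite !mxE /= gtn_eqF.
  by rewrite mul0mx.
have uD : u *m top _ (snf_mx p k d) = c%:Z *: (u *m top _ (invmx L *m Z *m invmx R)).
  have -> : snf_mx p k d = invmx L *m X *m (Y *m invmx R) + c%:Z *: (invmx L *m Z *m invmx R).
    have -> : invmx L *m X *m (Y *m invmx R) + c%:Z *: (invmx L *m Z *m invmx R)
        = invmx L *m (X *m Y + c%:Z *: Z) *m invmx R.
      by rewrite mulmxDr mulmxDl -scalemxAr -scalemxAl !mulmxA.
    by rewrite -MXY ME !mulmxA mulVmx // mul1mx mulmxK.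
  have topD q (N1 N2 : 'M_(p, q)) : top _ (N1 + N2) = top _ N1 + top _ N2.
    by apply/matrixP => i h; rewrite !mxE.
  have topM : top _ (invmx L *m X *m (Y *m invmx R)) = top _ (invmx L *m X) *m (Y *m invmx R).
    by rewrite /top mul_rowsub_mx.
  rewrite topD topM mulmxDr !(mulmxA u) uX !mul0mx add0r.
  rewrite [RHS]scalemxAr; congr (_ *m _).
  by apply/matrixP => i h; rewrite !mxE.
(* By [uD], [c] divides [u_i d_i], and [d_i] divides [d_j]. *)
have cu (i : 'I_j.+1) : (c%:Z %| u ord0 i * (nth 0%N d j)%:Z)%Z.
  have ij : (i <= j)%N by rewrite -ltnS ltn_ord.
  have /dvdnP[g ->] : (nth 0 d i %| nth 0 d j)%N by apply: invariant_factors_dvd.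
  rewrite PoszM mulrCA dvdz_mull //.
  have := congr1 (fun W : 'rV_k => W ord0 (widen_ord jk i)) uD; rewrite !mxE (bigD1 i) //=.
  rewrite big1 ?addr0 => [|h hi]; last first.
    by rewrite !mxE (_ : val h == val i = false) ?mulr0n ?mulr0 //; apply/negbTE.
  by rewrite !mxE eqxx mulr1n => ->; apply: dvdz_mulr.
(* The last diagonal entry of [invmx L2 *m L2] writes 1 as a combination of the entries of [u]. *)
have : (c%:Z %| (nth 0%N d j)%:Z)%Z.
  have := congr1 (fun W : 'M_j.+1 => W ord_max ord_max * (nth 0%N d j)%:Z) (mulVmx uL2).
  rewrite /= !mxE eqxx mul1r mulr_suml => <-.
  apply: rpred_sum => h _; rewrite mulrAC; apply: dvdz_mulr.
  by have := cu h; rewrite /u mxE.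
by rewrite dvdzE.
Qed.

(** Dropping the last column from a decomposition of [row_mx M c] gives one of [M] with the same
    modulus. *)
Lemma inv_factor_row_mx p k (M : 'M[int]_(p, k)) (c : 'cV[int]_p) j :
  (j < rankQ M)%N -> (j < rankQ (row_mx M c))%N ->
  (inv_factor (row_mx M c) j.+1 %| inv_factor M j.+1)%N.
Proof.
move=> jM jMc; apply/dvd_inv_factorP => //.
have /dvd_inv_factorP[//|X [Y [Z MXY]]] := dvdnn (inv_factor (row_mx M c) j.+1).
exists X, (lsubmx Y), (lsubmx Z).
have := congr1 lsubmx MXY; rewrite row_mxKl => {1}->.
by rewrite linearD linearZ /= -{1}[Y]hsubmxK mul_mx_row row_mxKl.
Qed.

(** Modulo [g], the gcd of [q] and the invariant factor of [M], the column [c] equals [M x]; adding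
    it does not raise the rank modulo [g]. *)
Lemma gcd_inv_factor_row_mx p k (M : 'M[int]_(p, k)) (c : 'cV[int]_p) q j :
  in_Col q M c -> (j < rankQ M)%N -> (j < rankQ (row_mx M c))%N ->
  gcdn q (inv_factor M j.+1) = gcdn q (inv_factor (row_mx M c) j.+1).
Proof.
move=> [x cE] jM jMc; apply/eqP; rewrite eqn_dvd; apply/andP; split; last first.
  by rewrite dvdn_gcd dvdn_gcdl (dvdn_trans (dvdn_gcdr _ _)) ?inv_factor_row_mx.
rewrite dvdn_gcd dvdn_gcdl; apply/dvd_inv_factorP => //.
have /dvd_inv_factorP[//|X [Y [Z MXY]]] := dvdn_gcdr q (inv_factor M j.+1).
set g := gcdn _ _ in MXY *.
pose y := M *m x; pose z : 'cV[int]_p := \col_i ((c i ord0 - y i ord0)%R %/ g%:Z)%Z.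
have zE : c = y + g%:Z *: z.
  apply/colP => i; rewrite !mxE mulrC divzK; first by rewrite addrC subrK.
  apply: (@dvdz_trans q%:Z); first by rewrite dvdzE dvdn_gcdl.
  rewrite -eqz_mod_dvd; apply/eqP. by rewrite cE mxE.
exists X, (row_mx Y (Y *m x)), (row_mx Z (Z *m x + z)).
rewrite mul_mx_row scale_row_mx add_row_mx -MXY; congr row_mx; rewrite [LHS]zE.
by rewrite /y MXY mulmxDl scalerDr addrA scalemxAl mulmxA.
Qed.

End InvariantFactors.

(** * Counting the solutions of linear systems modulo [q] *)

Section CountingModulo.

Variables (q : nat) (q_gt1 : (1 < q)%N).

Lemma natr_Zp_eq0 k : (k%:R == 0 :> 'Z_q) = (q %| k)%N.
Proof. by rewrite -val_eqE /= val_Zp_nat. Qed.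

Lemma intr_Zp_eq0 (z : int) : (z%:~R == 0 :> 'Z_q) = (q%:Z %| z)%Z.
Proof.
rewrite dvdzE absz_nat -natr_Zp_eq0 [z in LHS]intEsign rmorphM rmorph_sign /=.
by case: (z < 0); rewrite ?expr0 ?expr1 ?mul1r ?mulN1r ?oppr_eq0.
Qed.

(** With [q = e g] and [d = f g], where [e] and [f] are coprime, the solutions are the [g] multiples
    of [e]. *)
Lemma card_annihilator d : #|[set y : 'Z_q | d%:R * y == 0]| = gcdn d q.
Proof.
have q_gt0 := ltnW q_gt1; have g_gt0 : (0 < gcdn d q)%N by rewrite gcdn_gt0 q_gt0 orbT.
have [e qE] := dvdnP (dvdn_gcdr d q); have [f dE] := dvdnP (dvdn_gcdl d q).
set g := gcdn d q in g_gt0 qE dE *.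
have cef : coprime e f by rewrite /coprime -(eqn_pmul2r g_gt0) muln_gcdl -qE -dE gcdnC mul1n.
have e_gt0 : (0 < e)%N by move: q_gt0; rewrite qE muln_gt0 => /andP[].
have lt_q (i : 'I_g) : (i * e < q)%N by rewrite qE mulnC ltn_pmul2l.
pose h (i : 'I_g) : 'Z_q := (i * e)%N%:R.
have hE i : h i = (i * e)%N :> nat by rewrite /h val_Zp_nat // modn_small.
have h_inj : injective h.
  move=> i j /(congr1 val) /=; rewrite !hE => /eqP; rewrite eqn_pmul2r // => /eqP.
  exact: val_inj.
rewrite -[RHS]card_ord -(card_imset _ h_inj); congr #|pred_of_set _|.
apply/setP => y; rewrite inE -[y in LHS]natr_Zp -natrM natr_Zp_eq0.
have -> k : (q %| d * k)%N = (e %| k)%N.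
  by rewrite qE [X in (_ %| X * _)%N]dE mulnAC dvdn_pmul2r // Gauss_dvdr.
apply/idP/imsetP => [/dvdnP[i yE]|[i _ ->]]; last by rewrite hE dvdn_mull.
have ig : (i < g)%N.
  by rewrite -(ltn_pmul2r e_gt0) -yE mulnC -qE -[q in (_ < q)%N]Zp_cast.
by exists (Ordinal ig) => //; apply: val_inj; rewrite /= hE.
Qed.

Lemma card_cV_family (F : finType) n (P : 'I_n -> {set F}) :
  #|[set y : 'cV[F]_n | [forall i, y i 0 \in P i]]| = (\prod_(i < n) #|P i|)%N.
Proof.
have c_inj : injective (fun f : {ffun 'I_n -> F} => \col_i f i).
  by move=> f g /colP fg; apply/ffunP => i; have := fg i; rewrite !mxE.
have := card_family (fun i => mem (P i)); rewrite foldrE big_map -big_enum /= => <-.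
rewrite -(card_imset _ c_inj); apply: eq_card => y; rewrite inE.
apply/forallP/imsetP => [yP|[f /familyP fP ->] i]; last by rewrite mxE; apply: fP.
exists [ffun i => y i 0]; first by apply/familyP => i; rewrite ffunE; apply: yP.
by apply/colP => i; rewrite mxE ffunE.
Qed.

Definition solutions p n (N : 'M[int]_(p, n)) (c : 'cV[int]_p) : {set 'cV['Z_q]_n} :=
  [set z | map_mx intr N *m z == map_mx intr c].

(** The coordinates separate; those beyond [size d] are free and counted by [gcdn 0 q = q]. *)
Lemma card_solutions_snf p n (d : seq nat) : (size d <= p)%N ->
  #|solutions (snf_mx p n d) 0| = (\prod_(i < n) gcdn (nth 0 d i) q)%N.
Proof.
move=> dp; under eq_bigr do rewrite -card_annihilator.
rewrite -card_cV_family; apply: eq_card => y; rewrite !inE map_mx0.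
have DyE (i : 'I_p) : (map_mx intr (snf_mx p n d) *m y) i 0
    = \sum_(j < n | i == j :> nat) (nth 0%N d j)%:R * y j 0.
  rewrite mxE [RHS]big_mkcond; apply: eq_bigr => j _; rewrite !mxE.
  by case: eqP => [->|_]; rewrite ?mulr1n // mulr0n mul0r.
apply/eqP/forallP => [Dy0 j|dy0].
  rewrite inE; have [jd|dj] := ltnP j (size d); last by rewrite nth_default // mul0r.
  have := DyE (Ordinal (leq_trans jd dp)); rewrite Dy0 mxE (big_pred1 j) => [/esym/eqP//|h].
  by rewrite /= eq_sym.
apply/colP => i; rewrite DyE mxE big1 // => j _.
by have := dy0 j; rewrite inE => /eqP.
Qed.

(** Translation by a particular solution and the coordinate change [R] reduce the system to the
    homogeneous one in Smith form. *)
Lemma card_solutions p n (N : 'M[int]_(p, n)) c : in_Col q N c ->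
  #|solutions N c| = (\prod_(j < rankQ N) gcdn (inv_factor N j.+1) q * q ^ (n - rankQ N))%N.
Proof.
move=> [x xE]; have [L [R [uL uR NE]]] := invariant_factors_snf N.
have [_ _ size_d _] := invariant_factorsP N.
set d := invariant_factors N in NE size_d.
pose x0 : 'cV['Z_q]_n := map_mx intr x.
have Nx0 : map_mx intr N *m x0 = map_mx intr c.
  rewrite /x0 -map_mxM; apply/colP => i; rewrite !mxE; apply/eqP.
  by rewrite eq_sym -subr_eq0 -rmorphB intr_Zp_eq0 -eqz_mod_dvd; apply/eqP; rewrite xE mxE.
pose R' : 'M['Z_q]_n := map_mx intr R; pose L' : 'M['Z_q]_p := map_mx intr L.
have uR' : R' \in unitmx by apply: unitmx_intr.
have uL' : L' \in unitmx by apply: unitmx_intr.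
have g_inj : injective (fun y => x0 + invmx R' *m y).
  by move=> y y' /addrI/(congr1 (mulmx R')); rewrite !mulKVmx.
have -> : solutions N c = [set x0 + invmx R' *m y | y in solutions (snf_mx p n d) 0].
  apply/setP => z; rewrite inE -Nx0; apply/eqP/imsetP => [zE|[y]].
    exists (R' *m (z - x0)); last by rewrite mulKmx // addrC subrK.
    rewrite inE map_mx0; apply/eqP/(can_inj (mulKmx uL')).
    by rewrite !mulmxA -!map_mxM /= -NE mulmxBr zE subrr mulmx0.
  rewrite inE map_mx0 => /eqP yE ->; rewrite mulmxDr NE !map_mxM -!mulmxA mulKVmx // yE mulmx0.
  by rewrite addr0.
have rd : (rankQ N <= n)%N by apply: rank_leq_col.
move: size_d; rewrite leq_min => /andP[dp dn].
rewrite card_imset // card_solutions_snf //.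
rewrite -(big_mkord xpredT (fun i => gcdn (nth 0 d i) q)) (@big_cat_nat _ _ _ (rankQ N)) //=.
rewrite big_mkord; congr (_ * _)%N.
  by apply: eq_bigr => i _; rewrite inv_factorS.
rewrite -prod_nat_const_nat; apply: eq_big_nat => i /andP[ri _].
by rewrite nth_default ?gcd0n // size_invariant_factors.
Qed.

End CountingModulo.

(** * Consistency of linear systems and the dimension of their solution sets *)

Section LinearSystems.

Lemma rank_map_intr (R : realType) p k (M : 'M[int]_(p, k)) :
  \rank (map_mx intr M : 'M[R]_(p, k)) = rankQ M.
Proof.
rewrite /rankQ -(mxrank_map (ratr : {rmorphism rat -> R})); congr (\rank _).
by apply/matrixP => i j; rewrite !mxE /= ratr_int.
Qed.

Section Field.

Variable K : fieldType.

(** The row [(0, 1)] clears the column [c], leaving a block diagonal matrix. *)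
Lemma rank_row_mx_ind p n (C : 'M[K]_(p, n)) (c : 'cV[K]_p) :
  \rank (row_mx C c + (row_mx 0 1%:M : 'rV[K]_(n + 1)))%MS = (\rank C).+1.
Proof.
have -> : row_mx C c = row_mx C 0 + c *m row_mx 0 1%:M.
  by rewrite mul_mx_row mulmx0 mulmx1 add_row_mx addr0 add0r.
rewrite (addsmx_addKr _ (submxMl _ _)) addsmxE -/(block_mx C 0 0 1%:M).
by rewrite rank_diag_block_mx mxrank1 addn1.
Qed.

Lemma rank_row_mx_eq p n (C : 'M[K]_(p, n)) (c : 'cV[K]_p) :
  (\rank (row_mx C c) == \rank C)
  = ~~ ((row_mx 0 1%:M : 'rV[K]_(n + 1)) <= row_mx C c)%MS.
Proof.
have := rank_row_mx_ind C c; rewrite rank_add_row.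
by case: (_ <= _)%MS => /=; lia.
Qed.

Lemma row_mx_solvable p n (C : 'M[K]_(p, n)) (c : 'cV[K]_p) :
  (exists x, C *m x = c) <-> \rank (row_mx C c) = \rank C.
Proof.
have sub : (C^T <= (row_mx C c)^T)%MS.
  by rewrite tr_row_mx; apply: submx_trans (addsmxSl C^T c^T) _; rewrite addsmxE.
have := mxrank_leqif_sup sub; rewrite !mxrank_tr tr_row_mx => -[_ eqr].
have {}eqr : (\rank C == \rank (row_mx C c)) = (c^T <= C^T)%MS.
  by rewrite eqr col_mx_sub submx_refl.
split=> [[x Cx]|/esym/eqP].
  by apply/esym/eqP; rewrite eqr -Cx trmx_mul submxMl.
rewrite eqr => /submxP[y yE]; exists y^T.
by apply: trmx_inj; rewrite trmx_mul trmxK.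
Qed.

End Field.

Section AffineDimension.

Variables (R : realType) (n : nat).
Implicit Type X : set 'cV[R]_n.

(** Both base points lie in [X], so their difference lies in [U] and the two directions coincide. *)
Lemma is_affine_subspace_inj X d d' :
  is_affine_subspace X d -> is_affine_subspace X d' -> d = d'.
Proof.
move=> [x [U [<- XU]]] [x' [U' [<- XU']]].
have memX y : (y - x \in U) = (y - x' \in U').
  have eqX : [set z | z - x \in U]%classic y = [set z | z - x' \in U']%classic y.
    by rewrite -XU -XU'.
  by apply/idP/idP; [rewrite [is_true _]eqX | rewrite -[is_true _]eqX].
have x'U : x' - x \in U by rewrite memX subrr mem0v.
congr (\dim _); apply/vspaceP => u.
by rewrite -[u in RHS](addrK x') -memX -addrA rpredDr.
Qed.

Lemma affine_dimE X d : is_affine_subspace X d -> affine_dim X = d.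
Proof.
move=> Xd; apply: is_affine_subspace_inj (Xd).
exact: (xgetPex _ (ex_intro _ d Xd)).
Qed.

Lemma solutions_affine p (C : 'M[R]_(p, n)) (c : 'cV[R]_p) (x0 : 'cV[R]_n) :
  C *m x0 = c -> is_affine_subspace [set x | C *m x = c]%classic (n - \rank C).
Proof.
move=> Cx0; pose k := \rank (kermx C^T).
(* [f] parametrizes the kernel of [C] by coordinates in a basis; the transposes pass between row and
   column vectors. *)
pose f := linfun (trmx \o mulmxr (row_base (kermx C^T)) : 'rV[R]_k -> 'cV[R]_n).
have fE y : f y = (y *m row_base (kermx C^T))^T.
  by rewrite lfunE.
exists x0, (limg f); split.
  rewrite limg_dim_eq; first by rewrite dimvf /dim /= mul1n /k mxrank_ker mxrank_tr.
  apply/eqP; rewrite -subv0; apply/subvP => y; rewrite memv_cap memv_ker fE => /andP[_].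
  rewrite memv0 -trmx0 => /eqP/trmx_inj/eqP; rewrite mulmx_free_eq0 //.
  exact: row_base_free.
apply/seteqP; split=> x /=.
  move=> Cx; have : ((x - x0)^T <= row_base (kermx C^T))%MS.
    by rewrite eq_row_base; apply/sub_kermxP; rewrite -trmx_mul mulmxBr Cx Cx0 subrr trmx0.
  move=> /submxP[y yE]; apply/memv_imgP; exists y; first exact: memvf.
  by rewrite fE -yE trmxK.
move=> /memv_imgP[y _ yE]; rewrite -[x](subrK x0) mulmxDr yE fE Cx0.
rewrite -[C in C *m _]trmxK -trmx_mul; suff -> : y *m row_base (kermx C^T) *m C^T = 0.
  by rewrite trmx0 add0r.
by apply/sub_kermxP; rewrite (submx_trans (submxMl _ _)) // eq_row_base.
Qed.

End AffineDimension.

End LinearSystems.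

(** * The arrangement as a matroid of augmented rows *)

Section Arrangement.

Variables (R : realType) (m n l : nat).
Variables (A : 'M[int]_(m, n)) (a : 'cV[int]_m).
Variables (B : 'M[int]_(l, n)) (b : 'cV[int]_l).
Implicit Types (i : 'I_m) (J T : {set 'I_m}) (j q : nat).

(** Equations become rows with their right-hand side as last entry. [e_inf] is the contradictory
    equation [0 = 1], so [J] is central exactly when its span avoids [e_inf]. *)
Let base : 'M[rat]_(l, n + 1) := map_mx intr (row_mx B b).
Let vect i : 'rV[rat]_(n + 1) := map_mx intr (row i (row_mx A a)).
Let e_inf : 'rV[rat]_(n + 1) := row_mx 0 1%:M.
Let span J := rowspan base vect J.

Lemma span_CbarJ J : (span J :=: map_mx intr (CbarJ A a B b J))%MS.
Proof.
pose sub k (N : 'M[int]_(m, k)) := rowsub (fun i : 'I_#|J| => enum_val i) N.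
have -> : CbarJ A a B b J = col_mx (row_mx B b) (sub _ (row_mx A a)).
  rewrite /CbarJ /CJ /cJ -block_mxEh block_mxEv; congr col_mx.
  by apply/matrixP => i k; rewrite !mxE; case: (split k) => k'; rewrite mxE.
rewrite map_col_mx; apply/eqmxP/andP; split.
  apply/rowspan_subP; split; first by rewrite -addsmxE addsmxSl.
  move=> i iJ; rewrite -addsmxE; apply: submx_trans (addsmxSr _ _).
  have -> : vect i = row (enum_rank_in iJ i) (map_mx intr (sub _ (row_mx A a))).
    by apply/rowP => k; rewrite !mxE enum_rankK_in.
  exact: row_sub.
rewrite col_mx_sub base_rowspan; apply/row_subP => i.
have -> : row i (map_mx intr (sub _ (row_mx A a))) = vect (enum_val i).
  by apply/rowP => k; rewrite !mxE.
by apply: mem_rowspan; apply: enum_valP.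
Qed.

Lemma rank_span J : \rank (span J) = rbarJ A a B b J.
Proof. by rewrite span_CbarJ. Qed.

Lemma central_span J : (rbarJ A a B b J == rJ A B J) = ~~ (e_inf <= span J)%MS.
Proof. by rewrite span_CbarJ /rbarJ /rJ /rankQ map_row_mx rank_row_mx_eq. Qed.

Lemma rank_span_setT : \rank (span [set: 'I_m] + e_inf)%MS = (rankQ (col_mx B A)).+1.
Proof.
have spanE : (span [set: 'I_m] :=: map_mx intr (row_mx (col_mx B A) (col_mx b a)))%MS.
  rewrite -block_mxEh block_mxEv map_col_mx; apply/eqmxP/andP; split.
    apply/rowspan_subP; split; first by rewrite -addsmxE addsmxSl.
    move=> i _; rewrite /vect map_row -addsmxE.
    exact: submx_trans (row_sub _ _) (addsmxSr _ _).
  rewrite col_mx_sub base_rowspan; apply/row_subP => i.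
  by rewrite -map_row; apply: (mem_rowspan base vect (in_setT i)).
by rewrite (adds_eqmx spanE (eqmx_refl e_inf)) map_row_mx rank_row_mx_ind.
Qed.

Definition nbc_sets j : {set {set 'I_m}} :=
  [set J | [&& nbc base vect setT J, ~~ (e_inf <= span J)%MS & \rank (span J) == j]].

Lemma flatE J :
  flat R A a B b J = [set x | map_mx intr (CJ A B J) *m x = map_mx intr (cJ a b J)]%classic.
Proof.
apply/seteqP; split=> x /=.
  move=> [Bx Ax]; rewrite /CJ /cJ !map_col_mx mul_col_mx Bx; congr col_mx.
  apply/colP => i; have [_] := Ax (enum_val i) (enum_valP i).
  rewrite !mxE => <-; apply: eq_bigr => k _; by rewrite !mxE.
rewrite /CJ /cJ !map_col_mx mul_col_mx => /eq_col_mx[Bx Ax]; split=> // i iJ; split=> //.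
have := congr1 (fun W : 'cV_#|J| => W (enum_rank_in iJ i) ord0) Ax.
rewrite !mxE enum_rankK_in // => <-; apply: eq_bigr => k _.
by rewrite !mxE enum_rankK_in.
Qed.

Lemma flat_affine J : (flat R A a B b J !=set0)%classic ->
  is_affine_subspace (flat R A a B b J) (n - rJ A B J).
Proof.
by rewrite flatE => -[x0 /solutions_affine]; rewrite rank_map_intr.
Qed.

Lemma flat_neq0 J : `[< (flat R A a B b J !=set0)%classic >] = (rbarJ A a B b J == rJ A B J).
Proof.
rewrite /rbarJ /rJ -!(rank_map_intr R) /CbarJ map_row_mx flatE.
by apply/asboolP/eqP => /row_mx_solvable.
Qed.

Lemma rJ_leq J : (rJ A B J <= n)%N.
Proof. exact: rank_leq_col. Qed.

Lemma w_coefE j : (j <= n)%N ->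
  w_coef R A a B b j = (-1) ^+ (j - rankQ B) *
    \sum_(J : {set 'I_m} | (rbarJ A a B b J == rJ A B J) && (rJ A B J == j)) (-1) ^+ #|J|.
Proof.
move=> jn; rewrite /w_coef /char_poly_arr coef_sum; congr (_ * _).
rewrite [RHS]big_mkcondr; apply: eq_big => J; first exact: flat_neq0.
move=> /asboolP Jn0; rewrite coefZ coefXn (affine_dimE (flat_affine Jn0)).
(* Both [j] and [rJ A B J] are at most [n], so the truncated subtractions lose nothing. *)
have := rJ_leq J => rn; have -> : (n - j == n - rJ A B J)%N = (rJ A B J == j) by lia.
by case: eqP; rewrite ?mulr1 ?mulr0.
Qed.

Lemma dtilde1 J : dtilde A a B b J 1 = 1%N.
Proof.
rewrite /dtilde ifT; first by rewrite big1 // => i _; rewrite gcdn1.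
by apply/forallP => i; rewrite !gcd1n.
Qed.

Lemma gamma1E j : (j <= n)%N -> w_coef R A a B b j = gamma A a B b j 1.
Proof.
move=> jn; rewrite w_coefE // /gamma; congr (_ * _).
by apply: eq_bigr => J _; rewrite dtilde1 mulr1.
Qed.

(** * Coefficients as numbers of NBC sets, and their comparison modulo [q] *)

Section Central.

Hypothesis V_nonempty : (ambient R B b !=set0)%classic.
Hypothesis H_codim1 :
  forall i, codim_one (ambient R B b) (hyperplane R A a B b i).

Lemma rank_base : \rank base = rankQ B.
Proof.
have [x Bx] := V_nonempty.
have /row_mx_solvable : exists x, map_mx intr B *m x = map_mx intr b :> 'cV[R]_l by exists x.
by rewrite -map_row_mx !rank_map_intr.
Qed.

Lemma e_inf_notin : ~~ (e_inf <= base)%MS.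
Proof.
by rewrite /base map_row_mx -rank_row_mx_eq -map_row_mx; apply/eqP/rank_base.
Qed.

(** If the [i]-th equation were a combination of those of [B x = b], the hyperplane would be the
    whole ambient space, against codimension one. *)
Lemma vect_notin i : ~~ (vect i <= base)%MS.
Proof.
apply/negP => /submxP[y yE]; have [HV [d [Vd Hd]]] := H_codim1 i.
suff HE : hyperplane R A a B b i = ambient R B b.
  by rewrite HE in Hd; have := is_affine_subspace_inj Vd Hd; lia.
apply/seteqP; split=> // x Bx; split=> //.
have := congr1 (map_mx (ratr : rat -> R)) yE.
rewrite map_mxM /vect /base -!map_mx_comp.
have intrE p k (M : 'M[int]_(p, k)) : map_mx (ratr \o intr) M = map_mx intr M :> 'M[R]_(p, k).
  by apply/matrixP => h h'; rewrite !mxE /= ratr_int.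
rewrite !intrE row_row_mx !map_row_mx mul_mx_row => /eq_row_mx[-> aE].
by rewrite -mulmxA Bx -aE !mxE.
Qed.

(** An NBC set of rank [j] has [j - rankQ B] elements, so all signs cancel. [T] is left free for the
    subarrangements through a point. *)
Lemma sum_nbc_sets j T :
  (-1) ^+ (j - rankQ B) * \sum_(J : {set 'I_m} | (J \subset T) &&
      ((rbarJ A a B b J == rJ A B J) && (rJ A B J == j))) (-1) ^+ #|J|
  = \sum_(J : {set 'I_m} | nbc base vect T J &&
      (~~ (e_inf <= span J)%MS && (\rank (span J) == j))) 1 :> int.
Proof.
have PE J : (rbarJ A a B b J == rJ A B J) && (rJ A B J == j)
    = ~~ (e_inf <= span J)%MS && (\rank (span J) == j).
  by rewrite -central_span rank_span; case: eqP => // ->.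
under eq_bigl do rewrite PE.
rewrite (@sum_nbc _ _ _ _ base vect) => [|J i viJ]; last by rewrite /span !(rowspanU1_id viJ).
rewrite mulr_sumr; apply: eq_bigr => J /andP[nJ /andP[_ /eqP rJ]].
by rewrite -rJ (rank_nbc nJ) rank_base addKn -exprD addnn -signr_odd odd_double expr0.
Qed.

Lemma w_coef_nbc j : (j <= n)%N -> w_coef R A a B b j = #|nbc_sets j|%:Z.
Proof.
move=> jn; rewrite w_coefE //.
under eq_bigl => J do rewrite -[X in X && _]andTb -(subsetT J) -andbA.
rewrite sum_nbc_sets sumr_const -[X in _ = X]natz; congr (_ *+ _).
by apply: eq_card => J; rewrite !inE.
Qed.

Lemma nbc_sets_neq0 j : (rankQ B <= j <= rankQ (col_mx B A))%N -> (0 < #|nbc_sets j|)%N.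
Proof.
move=> jr; have := @nbc_exists _ _ _ _ base vect e_inf vect_notin e_inf_notin j.
rewrite rank_base -/span rank_span_setT ltnS => /(_ jr)[J [nJ eJ rJ]].
by apply/card_gt0P; exists J; rewrite inE nJ eJ rJ eqxx.
Qed.

Lemma dtilde_in_Col q J : rbarJ A a B b J = rJ A B J -> in_Col q (CJ A B J) (cJ a b J) ->
  dtilde A a B b J q = (\prod_(j < rJ A B J) gcdn (dJ A B J j.+1) q)%N.
Proof.
move=> rr Jq; rewrite /dtilde ifT //; apply/forallP => j.
by apply/eqP/gcd_inv_factor_row_mx => //; rewrite -/(rbarJ A a B b J) rr.
Qed.

(* [z] modulo [q] ranges over the solutions of [B z = b]; the [J]-th term counts
   the [z] lying on all the hyperplanes of [J], so that regrouping by the set [S z]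
   of hyperplanes through [z] gives a sum of coefficients of subarrangements. *)
Lemma beta_ge q j : (1 < q)%N -> (j <= n)%N ->
  (forall J, rbarJ A a B b J = rJ A B J -> in_Col q (CJ A B J) (cJ a b J)) ->
  #|nbc_sets j|%:Z <= beta A a B b j q.
Proof.
move=> q_gt1 jn colq; have q_gt0 := ltnW q_gt1.
pose sol J := solutions q (CJ A B J) (cJ a b J).
pose S (z : 'cV['Z_q]_n) : {set 'I_m} :=
  [set i | (map_mx intr (row i A) *m z) 0 0 == (a i 0)%:~R].
have solE J z : (z \in sol J) = (z \in solutions q B b) && (J \subset S z).
  rewrite !inE /CJ /cJ !map_col_mx mul_col_mx; apply/eqP/andP.
    move=> /eq_col_mx[-> Az]; rewrite eqxx; split=> //; apply/subsetP => i iJ; rewrite inE.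
    have := congr1 (fun W : 'cV_#|J| => W (enum_rank_in iJ i) ord0) Az.
    rewrite !mxE enum_rankK_in // => <-; apply/eqP/eq_bigr => k _.
    by rewrite !mxE enum_rankK_in.
  move=> [/eqP-> /subsetP Az]; congr col_mx; apply/colP => i.
  have := Az _ (enum_valP i); rewrite inE !mxE => /eqP <-; apply: eq_bigr => k _.
  by rewrite !mxE.
have card_sol J : rbarJ A a B b J = rJ A B J ->
    #|sol J| = (dtilde A a B b J q * q ^ (n - rJ A B J))%N.
  by move=> rr; rewrite (dtilde_in_Col rr) ?card_solutions //; apply: colq.
have q0 : 0 < (q ^ (n - j))%N%:Z by rewrite ltz_nat expn_gt0 q_gt0.
rewrite -(ler_pM2r q0).
have -> : beta A a B b j q * (q ^ (n - j))%N%:Z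
    = \sum_(z in solutions q B b) \sum_(J : {set 'I_m} | nbc base vect (S z) J &&
      (~~ (e_inf <= span J)%MS && (\rank (span J) == j))) 1.
  under [RHS]eq_bigr do rewrite -sum_nbc_sets.
  rewrite -mulr_sumr /beta -mulrA; congr (_ * _).
  pose central_j J := (rbarJ A a B b J == rJ A B J) && (rJ A B J == j).
  rewrite (exchange_big_dep central_j) /=; last by move=> z J _ /andP[].
  rewrite mulr_suml; apply: eq_bigr => J /andP[/eqP rr /eqP rj].
  rewrite -mulrA -PoszM -rj -card_sol // sumr_const -mulr_natr natz rr !eqxx; congr (_ * _%:Z).
  by apply: eq_card => z; rewrite solE [in RHS]unfold_in /= andbT.
have -> : #|nbc_sets j|%:Z * (q ^ (n - j))%N%:Z = \sum_(J in nbc_sets j) (q ^ (n - j))%N%:Z.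
  by rewrite sumr_const -mulr_natl natz.
(* A central [J] of rank [j] is solvable modulo [q], and its [dtilde] is a product of positive gcds,
   so it has at least [q ^ (n - j)] solutions. *)
apply: le_trans (_ : \sum_(J in nbc_sets j) #|sol J|%:Z <= _).
  apply: ler_sum => J; rewrite inE -central_span => /and3P[_ /eqP rr].
  rewrite rank_span rr => /eqP <-; rewrite lez_nat card_sol // leq_pmull //.
  rewrite dtilde_in_Col ?prodn_gt0 // => [k|]; last exact: colq.
  by rewrite gcdn_gt0 q_gt0 orbT.
under eq_bigr => J _ do rewrite -[#|sol J|%:Z]natz -sumr_const.
under eq_bigr => J _ do (under eq_bigl => z do rewrite solE).
(* Now the points come first: for each [z], the sets [J] of [nbc_sets j] contained in [S z] are NBC
   sets of [S z]. *)
rewrite (exchange_big_dep (mem (solutions q B b))) /=; last by move=> J z _ /andP[].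
apply: ler_sum => z zB; rewrite !sumr_const ler_nat; apply: subset_leq_card.
apply/subsetP => J /and3P[]; rewrite inE => /and3P[nJ eJ rJ] _ JS.
rewrite unfold_in eJ rJ andbT.
by rewrite (nbc_restrict (subsetT _) JS nJ).
Qed.

Lemma gamma_beta j q k : gcdn q (rhoC A a B b) = gcdn k (rhoC A a B b) ->
  gamma A a B b j k = beta A a B b j q.
Proof.
move=> qk; rewrite /gamma /beta; congr (_ * _).
apply: eq_bigr => J /andP[/eqP rr _].
(* For [d] dividing [rhoC], [gcd(q, d) = gcd(gcd(q, rhoC), d)]. *)
have gE d : (d %| rhoC A a B b)%N -> gcdn q d = gcdn k d.
  by move=> /gcdn_idPr <-; rewrite !gcdnA qk.
have dJ_rho (h : 'I_(rJ A B J)) : (dJ A B J h.+1 %| rhoC A a B b)%N.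
  apply: (@dvdn_trans (dJ A B J (rJ A B J))).
    by apply: inv_factor_dvd; rewrite ltn_ord leqnn.
  by apply: (@biglcmn_sup _ J); rewrite ?rr.
have dbar_rho (h : 'I_(rJ A B J)) : (dbarJ A a B b J h.+1 %| rhoC A a B b)%N.
  apply: dvdn_trans (dJ_rho h); apply: inv_factor_row_mx => //.
  by rewrite -/(rbarJ A a B b J) rr.
congr (_ * _%:Z); rewrite /dtilde.
have -> : [forall h : 'I_(rJ A B J), gcdn k (dJ A B J h.+1) == gcdn k (dbarJ A a B b J h.+1)]
    = [forall h : 'I_(rJ A B J), gcdn q (dJ A B J h.+1) == gcdn q (dbarJ A a B b J h.+1)].
  by apply: eq_forallb => h; rewrite !gE.
by case: ifP => // _; apply: eq_bigr => h _; rewrite ![gcdn _ k]gcdnC ![gcdn _ q]gcdnC gE.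
Qed.

Lemma coefficients j q k : (0 < q)%N -> (rankQ B <= j <= rankQ (col_mx B A))%N ->
  gcdn q (rhoC A a B b) = gcdn k (rhoC A a B b) ->
  (forall J, rbarJ A a B b J = rJ A B J -> in_Col q (CJ A B J) (cJ a b J)) ->
  [/\ 0 < w_coef R A a B b j, w_coef R A a B b j = gamma A a B b j 1,
      gamma A a B b j 1 <= gamma A a B b j k & gamma A a B b j k = beta A a B b j q].
Proof.
move=> q_gt0 jr qk colq; have jn : (j <= n)%N.
  by case/andP: jr => _ /leq_trans; apply; apply: rank_leq_col.
have gb := gamma_beta j qk; split=> //.
- by rewrite w_coef_nbc // ltz_nat nbc_sets_neq0.
- exact: gamma1E.
(* Since ['Z_1] is not the zero ring, [q = 1] is treated apart: there [beta] and [gamma] at 1 are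
   the same expression. *)
move: q_gt0; rewrite leq_eqVlt => /orP[/eqP q1|q_gt1].
  by rewrite gb -q1.
by rewrite gb -gamma1E // w_coef_nbc // beta_ge.
Qed.

End Central.

End Arrangement.

Unset Implicit Arguments.
Local Open Scope classical_set_scope.

Theorem corollary3p8 (R : realType) (m n l : nat)
  (A : 'M[int]_(m, n)) (avec : 'cV[int]_m)
  (B : 'M[int]_(l, n)) (bvec : 'cV[int]_l)
  (V_nonempty : ambient R B bvec !=set0)
  (H_codim1 : forall i : 'I_m,
     codim_one (ambient R B bvec) (hyperplane R A avec B bvec i)) :
  (forall q a : nat,
     (q0 A avec B bvec < q)%N ->
     (1 <= a <= rhoC A avec B bvec)%N ->
     gcdn q (rhoC A avec B bvec) = gcdn a (rhoC A avec B bvec) ->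
     (forall J : {set 'I_m}, rbarJ A avec B bvec J = rJ A B J ->
        in_Col q (CJ A B J) (cJ avec bvec J)) ->
     forall j : nat, (rankQ B <= j <= rankQ (col_mx B A))%N ->
       [/\ 0 < w_coef R A avec B bvec j,
           w_coef R A avec B bvec j = gamma A avec B bvec j 1,
           gamma A avec B bvec j 1 <= gamma A avec B bvec j a
         & gamma A avec B bvec j a = beta A avec B bvec j q])
  /\
  (avec = 0 -> bvec = 0 ->
   forall q a : nat,
     (1 <= q)%N ->
     (1 <= a <= rhoC A avec B bvec)%N ->
     gcdn q (rhoC A avec B bvec) = gcdn a (rhoC A avec B bvec) ->
     forall j : nat, (rankQ B <= j <= rankQ (col_mx B A))%N ->
       [/\ 0 < w_coef R A avec B bvec j,
           w_coef R A avec B bvec j = gamma A avec B bvec j 1,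
           gamma A avec B bvec j 1 <= gamma A avec B bvec j a
         & gamma A avec B bvec j a = beta A avec B bvec j q]).
Proof.
have coef := coefficients V_nonempty H_codim1.
split=> [q k q_gt _ qk colq j jr|a0 b0 q k q_gt0 _ qk j jr]; apply: (coef j q k) => //.
  exact: leq_ltn_trans q_gt.
(* With zero right-hand sides, [x = 0] solves every system modulo [q]. *)
move=> J _; exists 0 => i; congr (modz _ _); rewrite mulmx0 a0 b0 /cJ.
by rewrite [RHS]mxE mxE; case: (split i) => i'; rewrite !mxE.
Qed.
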